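(* Let $m$ be an odd positive integer and let $G$ be a dihedral group of order $2m$. Then every supercharacter theory of $G$ is isomorphic, as a supercharacter theory, to a supercharacter theory of the cyclic group $C_{2m}$ of order $2m$.
   Context: For a finite group $G$ with identity $e$, let $*$ denote the usual product on the group algebra $\mathbb{C}G$, and let $\circ$ denote the Hadamard product, $\left(\sum_{g\in G} a_g g\right)\circ\left(\sum_{g\in G} b_g g\right)=\sum_{g\in G}(a_g b_g) g$. A supercharacter theory for $G$ is a pair $(\mathcal{X},\mathcal{K})$, where $\mathcal{X}$ is a partition of the set $\operatorname{Irr}(G)$ of irreducible complex characters and $\mathcal{K}$ is a partition of the set of conjugacy classes of $G$ (each part being identified with the union of its classes, a subset of $G$), such that $\{e\}\in\mathcal{K}$, the singleton of the trivial character is in $\mathcal{X}$, $|\mathcal{X}|=|\mathcal{K}|$, and for each $X\in\mathcal{X}$ the function $\sigma_X=\sum_{\chi\in X}\chi(e)\chi$ is constant on each member of $\mathcal{K}$. Supercharacter theories of $G$ are in bijective correspondence with (and are identified with) the $\mathbb{C}$-linear subspaces $A$ of the center $Z(\mathbb{C}G)$ that contain $e$ and $\sum_{g\in G} g$ and are closed under both $*$ and $\circ$; the subspace corresponding to $(\mathcal{X},\mathcal{K})$ has basis $\{\widehat{L}: L\in\mathcal{K}\}$, where $\widehat{L}=\sum_{g\in L} g$. A homomorphism of supercharacter theories $\phi:A\to B$ (with $A$ a supercharacter theory for a finite group $G_1$ and $B$ one for a finite group $G_2$, both viewed as algebras) is a $\mathbb{C}$-linear map with $\phi(x*y)=\phi(x)*\phi(y)$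 and $\phi(x\circ y)=\phi(x)\circ\phi(y)$ for all $x,y\in A$; an isomorphism is a bijective homomorphism. *)

(* Defs.v *)
From HB Require Import structures.
From mathcomp Require Import all_boot all_order all_algebra.
From mathcomp Require Import all_fingroup all_solvable all_field all_character.

Set Implicit Arguments.
Unset Strict Implicit.
Unset Printing Implicit Defensive.

Import GroupScope GRing.Theory.
Local Open Scope ring_scope.

Definition sigma (gT : finGroupType) (G : {group gT}) (X : {set Iirr G}) :
    'CF(G) :=
  \sum_(i in X) 'chi_i 1%g *: 'chi_i.

(* The parts of [superclass_part] are sets of conjugacy classes; the subset of
   G with which such a part L is identified is [cover L]. The trivial character
   of G is 'chi_0, and {1} is the conjugacy class of the identity. *)
Record supercharacter_theory (gT : finGroupType) (G : {group gT}) := SuperTheory {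
  superchar_part : {set {set Iirr G}};
  superclass_part : {set {set {set gT}}};
  superchar_partP : partition superchar_part [set: Iirr G];
  superclass_partP : partition superclass_part (classes G);
  superclass1 : [set [set 1%g]] \in superclass_part;
  superchar1 : [set 0] \in superchar_part;
  card_super : #|superchar_part| = #|superclass_part|;
  super_constant : forall X L, X \in superchar_part -> L \in superclass_part ->
    {in cover L &, forall g h, sigma X g = sigma X h}
}.

(* The field C of scalars is any algebraically closed field with a conjugation
   and norm of complex type; this covers both R[i], for R the real numbers, and
   algC, where the irreducible characters take their values.
   The ambient space of the group algebra: a finite function a stands for the
   formal sum of the a g * g. For a group G contained in gT, the group algebra
   of G is the subspace of functions supported in G; it is stable under both
   products, which therefore do not mention G. *)
Notation galg C gT := {ffun gT -> C^o}.

Definition gconv (C : numClosedFieldType) (gT : finGroupType)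
    (a b : galg C gT) : galg C gT :=
  [ffun g => \sum_(h : gT) a h * b (h^-1 * g)%g].

Definition ghadamard (C : numClosedFieldType) (gT : finGroupType)
    (a b : galg C gT) : galg C gT :=
  [ffun g => a g * b g].

Definition set_sum (C : numClosedFieldType) (gT : finGroupType)
    (L : {set gT}) : galg C gT :=
  [ffun g => (g \in L)%:R].

Definition super_algebra (C : numClosedFieldType) (gT : finGroupType)
    (G : {group gT}) (S : supercharacter_theory G) : {vspace galg C gT} :=
  (\sum_(L in superclass_part S) <[set_sum C (cover L)]>)%VS.

(* Linear maps between the subspaces A and B are represented by linear maps of
   the ambient spaces, of which only the restriction to A matters: every linear
   map on A extends. *)
Definition super_hom (C : numClosedFieldType) (gT1 gT2 : finGroupType)
    (G1 : {group gT1}) (G2 : {group gT2})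
    (S1 : supercharacter_theory G1) (S2 : supercharacter_theory G2)
    (f : 'Hom(galg C gT1, galg C gT2)) : Prop :=
  [/\ (f @: super_algebra C S1 <= super_algebra C S2)%VS,
      {in super_algebra C S1 &, {morph f : a b / gconv a b}}
    & {in super_algebra C S1 &, {morph f : a b / ghadamard a b}}].

Definition super_isomorphic (C : numClosedFieldType) (gT1 gT2 : finGroupType)
    (G1 : {group gT1}) (G2 : {group gT2})
    (S1 : supercharacter_theory G1) (S2 : supercharacter_theory G2) : Prop :=
  exists f : 'Hom(galg C gT1, galg C gT2),
    [/\ super_hom S1 S2 f,
        {in super_algebra C S1 &, injective f}
      & (f @: super_algebra C S1)%VS = super_algebra C S2].

(* The dihedral group of order 2m, by its presentation rather than as
   'D_(2m), because the latter is only meaningful for m > 1; for m = 1 this is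
   the group of order 2. *)
Definition dihedral (gT : finGroupType) (m : nat) (G : {group gT}) : Prop :=
  G \isog Grp (x : y : x ^+ m, y ^+ 2, x ^ y = x^-1)%g.

(* Main.v *)
Require Import Defs.
From HB Require Import structures.
From mathcomp Require Import all_boot all_order all_algebra.
From mathcomp Require Import all_fingroup all_solvable all_field all_character.

Set Implicit Arguments.
Unset Strict Implicit.
Unset Printing Implicit Defensive.

Import GroupScope GRing.Theory Num.Theory.
Local Open Scope ring_scope.

(** In both groups pick a subgroup of order m, namely M in the cyclic group H
    and the rotations N in the dihedral group G, with an isomorphism f : M -> N,
    and extend f to a bijection t : H -> G carrying the coset H \ M onto the
    reflections. Although t is not a morphism, composition with t respects both
    products on class functions of G: the Hadamard product trivially, and
    convolution because m is odd, so that the reflections form a single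
    conjugacy class on which class functions are constant
    ([index2_correspondence]). Hence Z(CG) embeds in CH as a subspace closed
    under both products, and every supercharacter theory of G goes with it.

    A supercharacter theory being a pair of partitions, those of H have to be
    produced. The superclasses of H are the preimages under t of the
    superclasses of G. On the character side, composition with t sends
    chi(1) chi, a multiple of the central idempotent of chi, to a multiple of
    an idempotent of CH. These idempotents are orthogonal with sum 1, so each
    is a sum of primitive ones: chi(1) chi o t is the sum of a set of linear
    characters of H, and these sets partition Irr(H) ([irr_fusion]). Pulling
    back the partition of Irr(G) then turns sigma_X into sigma_X o t, which is
    constant on the preimages of the superclasses ([pull_theory]). Composition
    with t is the required isomorphism ([super_transfer]). *)

(** * Bijections preserving the convolution of class functions *)

Definition class_function (gT : finGroupType) (G : {set gT}) (R : Type)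
    (a : gT -> R) : Prop :=
  {in G &, forall g x, a (g ^ x)%g = a g}.

(** The properties of t that make composition with t an embedding of the center
    of the group algebra of G into the group algebra of H, for both products.
    Two coefficient rings occur below: algC for characters, and the field of
    scalars of the group algebras. *)
Record central_correspondence (hT gT : finGroupType) (H : {set hT})
    (G : {set gT}) (t : hT -> gT) : Prop := CentralCorrespondence {
  corr1 : t 1%g = 1%g;
  corr_inj : {in H &, injective t};
  corr_im : t @: H = G;
  corr_conv : forall (R : pzSemiRingType) (a b : gT -> R),
    class_function G a -> class_function G b ->
    {in H, forall h, \sum_(k in H) a (t k) * b (t (k^-1 * h))%g
                     = \sum_(g in G) a g * b (g^-1 * t h)%g}
}.

(** * Subgroups of index two *)

Lemma sum_coset (hT : finGroupType) (H M : {group hT}) (R : nmodType)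
    (F : hT -> R) (h : hT) :
    {in H &, forall x y, (x * y \in M)%g = ((x \in M) == (y \in M))} ->
    M \subset H -> h \in H :\: M ->
  \sum_(k in H :\: M) F (k^-1 * h)%g = \sum_(k in M) F k.
Proof.
move=> MM sMH /setDP[Hh notMh].
have inj_h : injective (fun k => h * k^-1)%g by move=> x y /mulgI/invg_inj.
rewrite (reindex_inj inj_h) /=; apply: eq_big => k; last first.
  by rewrite invMg invgK mulgKV.
rewrite inE (groupMl _ Hh) groupV; have [Hk | notHk] := boolP (k \in H).
  by rewrite MM ?groupV // (negPf notMh) andbT; case: (k \in M).
by rewrite andbF; apply/esym/negP=> /(subsetP sMH); apply/negP.
Qed.

Lemma mem_index2 (hT : finGroupType) (H M : {group hT}) :
    M \subset H -> #|H : M|%g = 2 ->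
  {in H &, forall x y, (x * y \in M)%g = ((x \in M) == (y \in M))}.
Proof.
move=> sMH iMH x y Hx Hy.
have [Mx | notMx] := boolP (x \in M); first by rewrite groupMl //; case: (y \in M).
have [My | notMy] := boolP (y \in M); first by rewrite groupMr // (negPf notMx).
have HMy : y^-1%g \in H :\: M by rewrite inE !groupV notMy.
have : x \in (M :* y^-1)%g by rewrite (rcoset_index2 sMH iMH HMy) inE notMx.
by rewrite mem_rcoset invgK => ->.
Qed.

(** Split a convolution sum at h over k in M and over k in H \ M. If k or h is
    in M, then t (k^-1 h) and (t k)^-1 (t h) agree, or both lie in G \ N, where
    class functions are constant. If neither is, the terms with k outside M
    match only in total: the first factor is constant, and the second runs over
    its values on N on either side. *)
Lemma index2_correspondence (hT gT : finGroupType) (H M : {group hT})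
    (G N : {group gT}) (y : gT) :
    M \subset H -> #|H : M|%g = 2 -> N \subset G -> #|G : N|%g = 2 ->
    M \isog N -> (y ^: G)%g = G :\: N ->
  exists t, central_correspondence H G t.
Proof.
move=> sMH iM sNG iN /isogP[f injf imf] yG.
have MM := mem_index2 sMH iM; have NN := mem_index2 sNG iN.
have Ny : y \in G :\: N by rewrite -yG class_refl.
have [Gy notNy] := setDP Ny.
have /set0Pn[w HMw] : H :\: M != set0.
  by rewrite setD_eq0 -indexg_eq1 iM.
have [Hw notMw] := setDP HMw.
pose t h := if h \in M then f h else (f (h * w^-1) * y)%g.
have fN h : h \in M -> f h \in N by move=> Mh; rewrite -imf mem_morphim.
have Mw h : h \in H -> h \notin M -> (h * w^-1)%g \in M.
  by move=> Hh /negPf notMh; rewrite MM ?groupV // notMh (negPf notMw).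
have tM h : h \in M -> t h = f h by rewrite /t => ->.
have tG h : h \in H -> t h \in G.
  rewrite /t; case: ifPn => [/fN/(subsetP sNG) | notMh Hh] //.
  by rewrite groupM // (subsetP sNG) ?fN ?Mw.
have tN h : h \in H -> (t h \in N) = (h \in M).
  rewrite /t; case: ifPn => [/fN | notMh Hh] //.
  by rewrite groupMl ?fN ?Mw // (negPf notNy).
have t_inj : {in H &, injective t}.
  move=> h k Hh Hk eq_t; have := tN h Hh; rewrite eq_t tN // => Mkh.
  move: eq_t; rewrite /t Mkh; case: ifPn => [Mh | notMh].
    by apply: (injmP injf); rewrite ?Mkh.
  move/mulIg; rewrite -Mkh in notMh => /(injmP injf) eq_w.
  by apply: (mulIg w^-1%g); apply: eq_w; rewrite Mw // -?Mkh.
have cardMN : #|M| = #|N| by rewrite -imf card_injm.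
have t_im : t @: H = G.
  apply/eqP; rewrite eqEcard card_in_imset // -(Lagrange sMH) -(Lagrange sNG).
  rewrite iM iN cardMN leqnn andbT.
  by apply/subsetP=> _ /imsetP[h Hh ->]; apply: tG.
exists t; split=> [||//|R a b aJ bJ h Hh] //.
  by rewrite tM // morph1.
have bN (c : gT -> R) : class_function G c -> {in G :\: N, forall g, c g = c y}.
  by move=> cJ g; rewrite -yG => /imsetP[x Gx ->]; rewrite cJ.
have tNC k : k \in H :\: M -> t k \in G :\: N.
  by case/setDP=> Hk notMk; rewrite inE tN // notMk tG.
rewrite -t_im big_imset //= (big_setID M) [RHS](big_setID M) /=.
rewrite !(setIidPr sMH); congr (_ + _).
  apply: eq_bigr => k Mk; congr (_ * _); have Hk := subsetP sMH k Mk.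
  have [Mh | notMh] := boolP (h \in M).
    by rewrite !tM ?groupM ?groupV // morphM ?groupV // morphV.
  rewrite !(bN b bJ) //.
    by rewrite inE NN ?groupV ?tG // !tN // Mk (negPf notMh) groupM ?groupV ?tG.
  by rewrite tNC // inE MM ?groupV // Mk (negPf notMh) groupM ?groupV.
have [Mh | notMh] := boolP (h \in M).
  apply: eq_bigr => k HMk; have [Hk notMk] := setDP HMk; congr (_ * _).
  rewrite !(bN b bJ) //.
    by rewrite inE NN ?groupV ?tG // !tN // Mh (negPf notMk) groupM ?groupV ?tG.
  by rewrite tNC // inE MM ?groupV // Mh (negPf notMk) groupM ?groupV.
have HMh : h \in H :\: M by rewrite inE notMh.
transitivity (a y * \sum_(n in N) b n).
  rewrite -imf morphimEdom big_imset /=; last exact/injmP.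
  rewrite -(sum_coset (fun k => b (f k)) MM sMH HMh) mulr_sumr.
  apply: eq_bigr => k HMk; rewrite (bN a aJ) ?tNC // tM //.
  have [Hk notMk] := setDP HMk.
  by rewrite MM ?groupV // (negPf notMk) (negPf notMh).
rewrite -(sum_coset b NN sNG (tNC h HMh)) mulr_sumr.
have -> : G :\: N = t @: (H :\: M).
  apply/setP=> g; apply/idP/imsetP=> [/setDP[] | [k HMk ->]]; last exact: tNC.
  rewrite -{1}t_im => /imsetP[k Hk ->]; rewrite tN // => notMk.
  by exists k; rewrite // inE notMk.
rewrite big_imset /=; last by apply: sub_in2 t_inj => k /setDP[].
by apply: eq_bigr => k HMk; rewrite (bN a aJ) ?tNC.
Qed.

(** * Pulling back partitions *)

(** The injectivity statement is what makes the two pulled back partitions of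
    equal size when the original ones are. *)
Lemma partition_preimset (aT rT : finType) (f : aT -> rT) (D : {set aT})
    (E : {set rT}) (P : {set {set rT}}) :
    partition P E -> f @: D = E ->
  partition [set D :&: f @^-1: X | X : {set rT} in P] D
  /\ {in P &, injective (fun X : {set rT} => D :&: f @^-1: X)}.
Proof.
move=> partP imD; have [covP tiP P0] := and3P partP.
have fD x : x \in D -> f x \in E by move=> Dx; rewrite -imD imset_f.
have injP : {in P &, injective (fun X : {set rT} => D :&: f @^-1: X)}.
  move=> X Y PX PY /= /setP eqXY.
  have /set0Pn[y Xy] := partition_neq0 partP PX.
  have : y \in E by rewrite (subsetP (partitionS partP PX)).
  rewrite -imD => /imsetP[x Dx def_y].
  have := eqXY x; rewrite !inE Dx -def_y Xy /= => /esym Yy.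
  by rewrite -(def_pblock tiP PX Xy) -(def_pblock tiP PY Yy).
split=> //; apply/and3P; split.
- apply/eqP/setP=> x; apply/bigcupP/idP => [[_ /imsetP[X _ ->]]|Dx].
    by case/setIP.
  have Ex: f x \in cover P by rewrite (eqP covP) fD.
  exists (D :&: f @^-1: pblock P (f x)); last by rewrite !inE Dx mem_pblock.
  by apply/imsetP; exists (pblock P (f x)); rewrite ?pblock_mem.
- apply/trivIsetP=> _ _ /imsetP[X PX ->] /imsetP[Y PY ->] neXY.
  rewrite -setI_eq0; apply/eqP/setP=> x; rewrite !inE.
  case: (x \in D) => //=; apply/negP=> /andP[Xx Yx]; case/eqP: neXY.
  by rewrite -(def_pblock tiP PX Xx) -(def_pblock tiP PY Yx).
apply/imsetP=> -[X PX /esym/eqP]; apply/negP.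
have /set0Pn[y Xy] := partition_neq0 partP PX.
have : y \in E by rewrite (subsetP (partitionS partP PX)).
rewrite -imD => /imsetP[x Dx def_y].
by apply/set0Pn; exists x; rewrite !inE Dx -def_y.
Qed.

(** * Fusion of the linear characters of an abelian group *)

Lemma abelian_cfun (hT : finGroupType) (H : {group hT}) (a : hT -> algC) :
  abelian H -> exists phi : 'CF(H), {in H, phi =1 a}.
Proof.
move=> cHH; pose b h := a h *+ (h \in H).
have fP : is_class_fun <<H>>%g (finfun b).
  rewrite genGid; apply: intro_class_fun => [h k Hh Hk | h /negPf]; last first.
    by rewrite /b => ->.
  by rewrite /conjg (centsP cHH h Hh k Hk) mulKg.
by exists (Cfun 0 fP) => h Hh; rewrite cfunE /b Hh.
Qed.

(** The Fourier coefficient at a linear character is multiplicative for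
    convolution. *)
Lemma fourier_conv (hT : finGroupType) (H : {group hT}) (xi : 'CF(H))
    (a b : hT -> algC) : xi \is a linear_char ->
  \sum_(h in H) (\sum_(k in H) a k * b (k^-1 * h)%g) * xi h^-1%g
  = (\sum_(k in H) a k * xi k^-1%g) * (\sum_(k in H) b k * xi k^-1%g).
Proof.
move=> lin_xi; rewrite big_distrlr /=.
under eq_bigr do rewrite mulr_suml.
rewrite exchange_big /=; apply: eq_bigr => k Hk.
rewrite (reindex_inj (mulgI k)) /=.
apply: eq_big => [h | h]; rewrite groupMl // => Hh.
by rewrite mulKg invMg lin_charM ?groupV // [X in _ * X]mulrC mulrACA.
Qed.

Lemma cfun_class_function (gT : finGroupType) (G : {group gT}) (phi : 'CF(G)) :
  class_function G phi.
Proof. by move=> g x _ Gx; rewrite cfunJ. Qed.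

(** The generalized orthogonality relation, written as a convolution: up to
    scaling, irreducible characters are orthogonal central idempotents. *)
Lemma irr_conv (gT : finGroupType) (G : {group gT}) (i j : Iirr G) (y : gT) :
  \sum_(g in G) 'chi_i g * 'chi_j (g^-1 * y)%g
  = (i == j)%:R * (#|G|%:R * 'chi_i y / 'chi_i 1%g).
Proof.
rewrite (reindex_inj invg_inj) /=.
have /(canRL (mulVKf (neq0CG G))) := generalized_orthogonality_relation y j i.
rewrite eq_sym => eq_ij.
transitivity (\sum_(x in G) 'chi_j (x * y)%g * 'chi_i x^-1%g).
  by apply: eq_big => x; rewrite ?groupV // invgK mulrC.
rewrite eq_ij; case: eqP => [-> | _]; last by rewrite !mul0r mulr0.
by rewrite !mul1r mulrA.
Qed.

(** The functions chi_i(1) chi_i o t, divided by |H|, are orthogonal idempotents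
    for convolution on H, with sum 1. So their Fourier coefficients at a given
    linear character of H are orthogonal idempotent scalars of sum 1: exactly
    one of them is 1, and [idx] records its index i. *)
Lemma irr_fusion (hT gT : finGroupType) (H : {group hT}) (G : {group gT})
    (t : hT -> gT) : abelian H -> central_correspondence H G t ->
  exists idx : Iirr H -> Iirr G, forall i, {in H, forall h,
    'chi_i 1%g * 'chi_i (t h) = \sum_(j | idx j == i) 'chi_j h}.
Proof.
move=> cHH tP; have linH j := char_abelianP H cHH j.
have cardHG : #|H| = #|G| by rewrite -(corr_im tP) (card_in_imset (corr_inj tP)).
have [phi phiE] := fin_all_exists
  (fun i : Iirr G => abelian_cfun (fun h => 'chi_i 1%g * 'chi_i (t h)) cHH).
pose c i j := '[phi i, 'chi_j].
have cE i j : \sum_(k in H) phi i k * 'chi_j k^-1%g = #|H|%:R * c i j.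
  rewrite /c cfdotE mulVKf ?neq0CG //; apply: eq_bigr => k Hk.
  by rewrite lin_charV_conj.
have c_idem i i' j : c i j * c i' j = (i == i')%:R * c i j.
  apply: (mulfI (neq0CG H)); apply: (mulfI (neq0CG H)).
  rewrite mulrA [LHS]mulrACA (mulrCA _ (i == i')%:R) -!cE -fourier_conv //.
  rewrite !mulr_sumr.
  apply: eq_bigr => h Hh; rewrite !mulrA; congr (_ * _).
  have conv := corr_conv tP (cfun_class_function 'chi_i)
    (cfun_class_function 'chi_i') Hh.
  transitivity ('chi_i 1%g * 'chi_i' 1%g
                * \sum_(k in H) 'chi_i (t k) * 'chi_i' (t (k^-1 * h))%g).
    rewrite mulr_sumr; apply: eq_bigr => k Hk.
    by rewrite !phiE ?groupM ?groupV // mulrACA.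
  rewrite conv irr_conv phiE // cardHG.
  case: eqP => [<- | _]; last by rewrite !(mul0r, mulr0).
  by rewrite !mul1r mulr1 mulrACA divff ?irr1_neq0 // mulr1 mulrCA.
(* Both regular characters are supported at the identity, which t fixes. *)
have sum_c j : \sum_i c i j = 1.
  rewrite /c -cfdot_suml.
  have -> : \sum_i phi i = cfReg H.
    apply/cfun_inP=> h Hh; rewrite sum_cfunE cfRegE cardHG.
    transitivity (cfReg G (t h)).
      rewrite cfReg_sum sum_cfunE; apply: eq_bigr => i _.
      by rewrite phiE // cfunE.
    by rewrite cfRegE -(corr1 tP) (inj_in_eq (corr_inj tP)).
  rewrite cfReg_sum cfdot_suml (bigD1 j) //= big1 => [|k /negPf nekj].
    by rewrite cfdotZl cfdot_irr eqxx lin_char1 // mul1r addr0.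
  by rewrite cfdotZl cfdot_irr nekj mulr0.
have c_unique j : exists i, forall i', c i' j = (i' == i)%:R.
  have [i /andP[_ nz_c]] : exists i, true && (c i j != 0).
    apply/existsP; apply: contraT => /existsPn c0.
    have /eqP := sum_c j; rewrite big1 1?eq_sym ?oner_eq0 // => i _.
    by apply/eqP; move: (c0 i); rewrite negbK.
  exists i => i'; have := c_idem i' i j; case: (eqVneq i' i) => [-> | _].
    by rewrite mul1r -[X in _ = X -> _]mulr1 => /(mulfI nz_c).
  by rewrite mul0r => /eqP; rewrite mulf_eq0 (negPf nz_c) orbF => /eqP.
have [idx idxE] := fin_all_exists c_unique.
exists idx => i h Hh; rewrite -phiE // {1}[phi i]cfun_sum_cfdot sum_cfunE.
rewrite [RHS]big_mkcond; apply: eq_bigr => j _.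
rewrite cfunE -/(c i j) idxE eq_sym.
by case: ifP; rewrite ?mul1r ?mul0r.
Qed.

(** * The pulled back supercharacter theory *)

Lemma mem_super_cover (gT : finGroupType) (G : {group gT})
    (S : supercharacter_theory G) (L : {set {set gT}}) (g : gT) :
  L \in superclass_part S -> (g \in cover L) = (g \in G) && ((g ^: G)%g \in L).
Proof.
move=> SL; have sLG := partitionS (superclass_partP S) SL.
apply/bigcupP/andP=> [[B LB Bg] | [Gg Lg]]; last first.
  by exists (g ^: G)%g; rewrite ?class_refl.
have /imsetP[x Gx defB] := subsetP sLG _ LB; rewrite defB in Bg LB.
by rewrite (class_eqP Bg) (subsetP (class_subG Gx (subxx G))).
Qed.

(** The map on classes induced by t when H is abelian, so that the class B is a
    singleton and [repr B] its only element. *)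
Definition class_map (hT gT : finGroupType) (G : {set gT}) (t : hT -> gT)
    (B : {set hT}) : {set gT} := (t (repr B) ^: G)%g.

Section Transfer.

Variables (hT gT : finGroupType) (H : {group hT}) (G : {group gT}).
Variable t : hT -> gT.
Hypotheses (cHH : abelian H) (tP : central_correspondence H G t).
Variable S : supercharacter_theory G.

Lemma corr_mem h : h \in H -> t h \in G.
Proof. by move=> Hh; rewrite -(corr_im tP) imset_f. Qed.

Let classH h : h \in H -> (h ^: H)%g = [set h].
Proof. exact: (abelian_classP H cHH). Qed.

Let class_map1 h : class_map G t [set h] = (t h ^: G)%g.
Proof. by rewrite /class_map repr_set1. Qed.

Lemma class_map_im : class_map G t @: classes H = classes G.
Proof.
apply/setP=> B; apply/imsetP/imsetP=> [[_ /imsetP[h Hh ->] ->] | [g]].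
  by exists (t h); rewrite ?corr_mem // classH // class_map1.
rewrite -{1}(corr_im tP) => /imsetP[h Hh ->] ->.
by exists [set h]; rewrite ?class_map1 // -(classH Hh) mem_classes.
Qed.

Definition pull_superclass (L : {set {set gT}}) : {set {set hT}} :=
  classes H :&: class_map G t @^-1: L.

Lemma mem_pull_cover (L : {set {set gT}}) h : L \in superclass_part S ->
  (h \in cover (pull_superclass L)) = (h \in H) && (t h \in cover L).
Proof.
move=> SL; rewrite (mem_super_cover _ SL).
apply/bigcupP/andP=> [[_ /setIP[/imsetP[k Hk ->]]] | [Hh /andP[_ Lh]]].
  by rewrite inE classH // class_map1 => Lk /set1P->; rewrite Hk corr_mem.
by exists [set h]; rewrite ?set11 // 2!inE class_map1 Lh -(classH Hh) mem_classes.
Qed.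

Lemma pull_theory :
  exists T : supercharacter_theory H,
    superclass_part T = pull_superclass @: superclass_part S.
Proof.
have [idx idxE] := irr_fusion cHH tP.
have [partK injK] := partition_preimset (superclass_partP S) class_map_im.
have idx_im : idx @: [set: Iirr H] = [set: Iirr G].
  apply/setP=> i; rewrite inE; apply: contraT => /imsetP no_j.
  have := idxE i 1%g (group1 H); rewrite (corr1 tP) big_pred0 => [|j].
    by move/eqP; rewrite mulf_eq0 orbb (negPf (irr1_neq0 i)).
  by apply/eqP=> def_i; case: no_j; exists j.
have [partX injX] := partition_preimset (superchar_partP S) idx_im.
have K1 : [set [set 1%g]] \in pull_superclass @: superclass_part S.
  apply/imsetP; exists [set [set 1%g]]; first exact: superclass1.
  apply/setP=> B; rewrite !inE.
  apply/eqP/andP=> [-> | [/imsetP[h Hh ->]]].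
    by rewrite class_map1 (corr1 tP) class1G eqxx -(classH (group1 H)) mem_classes.
  rewrite classH // class_map1 => /eqP th1; congr [set _].
  apply: (corr_inj tP) => //; rewrite (corr1 tP); apply/set1P.
  by rewrite -th1 class_refl.
(* The fiber over the trivial character has as many elements as the value 1 of
   its sum at the identity; and its only element is that sum. *)
have idx0 : idx @^-1: [set 0] = [set 0].
  have /eqP: #|idx @^-1: [set 0]|%:R = 1 :> algC.
    have := idxE 0 1%g (group1 H); rewrite (corr1 tP) irr0 cfun11 mulr1 => eq1.
    rewrite [RHS]eq1 -sumr_const; apply: eq_big => [j | j _]; first by rewrite !inE.
    by rewrite lin_char1 ?(char_abelianP H cHH).
  rewrite pnatr_eq1 => /cards1P[j0 def_j0]; rewrite def_j0; congr [set _].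
  apply/eqP; rewrite -irr_eq1; apply/eqP/cfun_inP=> h Hh.
  have := idxE 0 h Hh; rewrite irr0 !cfun1E group1 corr_mem // mulr1 => eq1.
  rewrite Hh [RHS]eq1 (big_pred1 j0) // => j; have /setP/(_ j) := def_j0.
  by rewrite !inE.
pose X := [set [set: Iirr H] :&: idx @^-1: Y
            | Y : {set Iirr G} in superchar_part S].
have X1 : [set 0] \in X.
  apply/imsetP; exists [set 0]; first exact: superchar1.
  by rewrite setTI idx0.
have cardXK : #|X| = #|pull_superclass @: superclass_part S|.
  by rewrite !card_in_imset // card_super.
(* The characters of H have degree 1, so the sum over the fiber of idx over i is
   the contribution of that fiber to sigma; by fusion it equals the
   contribution chi_i(1) chi_i o t of i. *)
have sigmaE (Y : {set Iirr G}) h :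
    h \in H -> sigma (idx @^-1: Y) h = sigma Y (t h).
  move=> Hh; rewrite !sum_cfunE (partition_big idx [in Y]) /= => [|j]; last first.
    by rewrite inE.
  apply: eq_bigr => i Yi; rewrite cfunE idxE //; apply: eq_big => [j | j _].
    by rewrite !inE; case: eqP => [-> | _]; rewrite ?andbF ?Yi.
  by rewrite cfunE lin_char1 ?(char_abelianP H cHH) // mul1r.
have constX (Y : {set Iirr H}) (L : {set {set hT}}) :
    Y \in X -> L \in pull_superclass @: superclass_part S ->
    {in cover L &, forall g h, sigma Y g = sigma Y h}.
  case/imsetP=> Y' SY ->; case/imsetP=> L' SL -> g h.
  rewrite !mem_pull_cover // => /andP[Hg Lg] /andP[Hh Lh].
  by rewrite setTI !sigmaE //; apply: super_constant SY SL _ _ Lg Lh.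
by exists (SuperTheory partX partK K1 X1 cardXK constX).
Qed.

End Transfer.

(** * The isomorphism of algebras *)

Lemma super_algebra_central (C : numClosedFieldType) (gT : finGroupType)
    (G : {group gT}) (S : supercharacter_theory G) (a : galg C gT) :
  a \in super_algebra C S ->
  class_function G a /\ forall g, g \notin G -> a g = 0.
Proof.
case/memv_sumP=> v v_line ->.
have {}v_line L : L \in superclass_part S ->
    exists c, forall g, v L g = c * (g \in cover L)%:R.
  by move=> /v_line/vlineP[c ->]; exists c => g; rewrite !ffunE.
split=> [g x Gg Gx | g notGg]; rewrite !sum_ffunE.
  apply: eq_bigr => L SL; have [c vE] := v_line L SL; rewrite !vE.
  by rewrite !(mem_super_cover _ SL) groupJ // classGidl // Gg.
apply: big1 => L SL; have [c ->] := v_line L SL.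
by rewrite (mem_super_cover _ SL) (negPf notGg) mulr0.
Qed.

Definition pull_elt (C : numClosedFieldType) (hT gT : finGroupType)
    (H : {set hT}) (t : hT -> gT) (a : galg C gT) : galg C hT :=
  [ffun h => a (t h) *+ (h \in H)].

Lemma pull_elt_linear (C : numClosedFieldType) (hT gT : finGroupType)
    (H : {set hT}) (t : hT -> gT) : linear (@pull_elt C hT gT H t).
Proof.
by move=> c a b; apply/ffunP=> h; rewrite !ffunE mulrnDl scalerMnr.
Qed.

HB.instance Definition _ (C : numClosedFieldType) (hT gT : finGroupType)
    (H : {set hT}) (t : hT -> gT) :=
  GRing.isLinear.Build C (galg C gT) (galg C hT) *:%R (@pull_elt C hT gT H t)
    (@pull_elt_linear C hT gT H t).

(** Restriction along t sends the indicator of a superclass of G to that of its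
    preimage, hence maps the one algebra onto the other; it is injective on
    functions supported in G because t maps H onto G. *)
Lemma super_transfer (C : numClosedFieldType) (hT gT : finGroupType)
    (H : {group hT}) (G : {group gT}) (t : hT -> gT)
    (S : supercharacter_theory G) :
    abelian H -> central_correspondence H G t ->
  exists T : supercharacter_theory H, super_isomorphic C S T.
Proof.
move=> cHH tP; have [T defT] := pull_theory cHH tP S; exists T.
have tG := corr_mem tP.
pose f : 'Hom(galg C gT, galg C hT) := linfun (@pull_elt C hT gT H t).
have fE a : f a = pull_elt H t a by rewrite lfunE.
have [_ injK] := partition_preimset (superclass_partP S) (class_map_im cHH tP).
have f_im : (f @: super_algebra C S)%VS = super_algebra C T.
  rewrite /super_algebra limg_sum defT big_imset //=.
  apply: eq_bigr => L SL; rewrite limg_line fE; congr <[_]>%VS.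
  apply/ffunP=> h; rewrite !ffunE (mem_pull_cover cHH tP _ SL).
  by case: (h \in H); rewrite ?mulr0n.
exists f; split=> //; last first.
  move=> a b /super_algebra_central[_ a0] /super_algebra_central[_ b0] /ffunP eq_ab.
  apply/ffunP=> g; have [Gg | notGg] := boolP (g \in G); last by rewrite a0 ?b0.
  rewrite -(corr_im tP) in Gg; have [h Hh ->] := imsetP Gg.
  by have := eq_ab h; rewrite !fE !ffunE Hh.
split=> [|a b /super_algebra_central[aJ a0] /super_algebra_central[bJ b0] | a b _ _].
- by rewrite f_im.
- apply/ffunP=> h; rewrite !fE !ffunE.
  rewrite -[RHS](big_rmcond _ _ (P := [in H])) /= => [|k /negPf notHk]; last first.
    by rewrite ffunE notHk mulr0n mul0r.
  rewrite -[X in X *+ _](big_rmcond _ _ (P := [in G])) /= => [|g /a0->].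
    2: by rewrite mul0r.
  have [Hh | notHh] := boolP (h \in H); last first.
    rewrite [RHS]big1 // => k Hk; rewrite !ffunE groupMl ?groupV // (negPf notHh).
    by rewrite mulr0.
  rewrite mulr1n -(corr_conv tP) //; apply: eq_bigr => k Hk.
  by rewrite !ffunE Hk groupM ?groupV.
by apply/ffunP=> h; rewrite !fE !ffunE; case: (h \in H); rewrite ?mul0r.
Qed.

(** * Dihedral groups of order 2m with m odd *)

(** The presentation bounds the order of G above by 2m, and below because G maps
    onto any group satisfying the relations: the standard dihedral group if
    m > 1, a group of order 2 if m = 1. Oddness of m makes every rotation a
    square k^2, and k^2 y is the conjugate of y by k^-1. *)
Lemma dihedral_structure (m : nat) (gT : finGroupType) (G : {group gT}) :
    odd m -> dihedral m G ->
  exists x y, [/\ <[x]>%g \subset G, #[x]%g = m, #|G| = (2 * m)%N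
    & (y ^: G)%g = G :\: <[x]>%g].
Proof.
move=> odd_m dihG; have m_gt0 : (0 < m)%N by case: m odd_m {dihG}.
have cardG : (2 * m <= #|G|)%N.
  have [m_gt1 | m_le1] := ltnP 1 m.
    rewrite mul2n -(card_dihedral m_gt1) leq_homg // dihG.
    by rewrite -Grp_dihedral // homg_refl.
  have m1 : m = 1%N by apply/eqP; rewrite eqn_leq m_le1.
  rewrite m1 in dihG *.
  have -> : (2 * 1 = #|[set: 'Z_2]|)%N by rewrite cardsT card_ord.
  rewrite leq_homg // dihG; apply/existsP; exists (0, 1 : 'Z_2) => /=.
  by rewrite !xpair_eqE cycle1 joing1G [in X in X && _]Zp_cycle eqxx.
have : G \homg G by apply: homg_refl.
rewrite dihG => /existsP[[x y]] /=; rewrite !xpair_eqE /=.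
case/and4P=> /eqP defG /eqP xm /eqP y2 /eqP xy.
have [sxG Gy] : <[x]>%g \subset G /\ y \in G.
  by rewrite -defG joing_subl -cycle_subG joing_subr.
have ox_le : (#[x]%g <= m)%N by rewrite dvdn_leq // order_dvdn xm.
have oy_le : (#[y]%g <= 2)%N by rewrite dvdn_leq // order_dvdn y2.
have nxy : (<[y]> \subset 'N(<[x]>))%g by rewrite norms_cycle xy groupV cycle_id.
have oxy : (#|G| <= #[x]%g * #[y]%g)%N.
  by rewrite -defG norm_joinEr // [leqRHS]mul_cardG leq_pmulr ?cardG_gt0.
have oG : #|G| = (2 * m)%N.
  apply/eqP; rewrite eqn_leq cardG andbT mulnC (leq_trans oxy) //.
  exact: leq_mul.
have ox : #[x]%g = m.
  apply/eqP; rewrite eqn_leq ox_le -(leq_pmul2l (isT : 0 < 2)%N) -oG.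
  by rewrite (leq_trans oxy) // mulnC leq_mul2r oy_le orbT.
have iN : #|G : <[x]>|%g = 2.
  by rewrite -divgS // oG -orderE ox mulnK.
have nxG : G \subset 'N(<[x]>)%g by apply: normal_norm (index2_normal sxG iN).
have notNy : y \notin <[x]>%g.
  apply/negP=> xy_in; have : G \subset <[x]>%g.
    by rewrite -defG join_subG subxx cycle_subG.
  by rewrite -indexg_eq1 iN.
have y_inv k : k \in <[x]>%g -> (y * k^-1 = k * y)%g.
  by case/cycleP=> i ->; rewrite [RHS]conjgC conjXg xy expgVn.
exists x, y; split=> //; apply/setP=> g.
apply/imsetP/setDP=> [[h Gh ->] | [Gg notNg]].
  by rewrite groupJ // memJ_norm // (subsetP nxG).
have : g \in (<[x]> :* y)%g by rewrite (rcoset_index2 sxG iN) inE ?notNg ?notNy.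
case/rcosetP=> n Nn ->.
have co2 : coprime #|<[x]>%g| 2 by rewrite -orderE ox coprimen2.
pose k := (n ^+ expg_invn <[x]> 2)%g; have Nk : k \in <[x]>%g by apply: groupX.
exists k^-1%g; first by rewrite groupV (subsetP sxG).
rewrite /conjg invgK y_inv // mulgA -expg2.
by rewrite /k expgAC (expgK co2).
Qed.

Theorem corollary1 (C : numClosedFieldType) (m : nat) (odd_m : odd m)
    (gT : finGroupType) (G : {group gT}) (dihG : dihedral m G)
    (hT : finGroupType) (H : {group hT}) (cycH : cyclic H)
    (cardH : #|H| = (2 * m)%N) (S : supercharacter_theory G) :
  exists T : supercharacter_theory H, super_isomorphic C S T.
Proof.
have [x [y [sxG ox oG yG]]] := dihedral_structure odd_m dihG.
have m_gt0 : (0 < m)%N by rewrite -ox order_gt0.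
have [h defH] := cyclicP cycH.
have oh2 : #[h ^+ 2]%g = m by rewrite orderXdiv orderE -defH cardH ?dvdn_mulr ?mulKn.
have sh2H : <[h ^+ 2]>%g \subset H by rewrite defH cycleX.
have [t tP] : exists t, central_correspondence H G t.
  apply: (index2_correspondence (M := <[h ^+ 2]>%G) (N := <[x]>%G)) yG => //.
  - by rewrite -divgS // cardH -orderE oh2 mulnK.
  - by rewrite -divgS // oG -orderE ox mulnK.
  by rewrite isog_cyclic_card ?cycle_cyclic //= -!orderE oh2 ox.
exact: super_transfer (cyclic_abelian cycH) tP.
Qed.
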